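(* For all integers $d,m\ge1$ there exists a constant $C_{m,d}>0$ depending only on $m,d$ such that for all $B>0$ and $n\ge1$, \[{}^*\sigma^{\mathrm{ad}}_n(\mathcal F_{d,m,B},S_L,D_{\mathrm{abs}})\le O_{m,d}\Big(\min\big\{Bn^{-m/d},\ \exp(C_{m,d}Bn^{-m/d})\,B\,n^{-1/2-m/d}\big\}\Big).\]
   Context: Let $\mathcal X=[0,1]^d$ with Lebesgue measure. For bounded measurable $f:\mathcal X\to\mathbb R$ let $L_f=\log\int_{\mathcal X}e^{f(x)}dx$. For $f\in C^m(\mathcal X)$, $\|f\|_{C^m}=\sup_{\alpha\in\mathbb N_0^d,|\alpha|_1\le m}\|\partial^\alpha f\|_\infty$, and $\mathcal F_{d,m,B}=\{f\in C^m(\mathcal X):\|f\|_{C^m}\le B\}$. $S_L(f)=L_f$, $D_{\mathrm{abs}}(a,b)=|a-b|$. $\mathcal A^{\mathrm{ad}}_n$ is the set of maps $\tilde S=\phi\circ N$ from functions to $\mathbb R$ with $N(f)=(f(x_1),f(x_2),\dots,f(x_n))$, where each $x_k\in\mathcal X$ may depend on $f(x_1),\dots,f(x_{k-1})$, and $\phi:\mathbb R^n\to\mathbb R$ arbitrary. The stochastic adaptive minimax error is ${}^*\sigma^{\mathrm{ad}}_n(\mathcal F,S,D)=\inf\sup_{f\in\mathcal F}\mathbb E_{\omega\sim P_\Omega}D(S(f),\tilde S(\omega)(f))$, where the infimum is over probability spaces $(\Omega,P_\Omega)$ and random variables $\tilde S:\Omega\to\mathcal A^{\mathrm{ad}}_n$.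 Asymptotic notation: $g\le O_{m,d}(h)$ means that for all $m,d$ there is $C'_{m,d}>0$ with $g\le C'_{m,d}h$ for all $B>0$ and all $n\ge1$. *)

(* Defs.v *)
From HB Require Import structures.
From mathcomp Require Import all_boot all_order all_algebra.
From mathcomp Require Import all_classical all_reals all_analysis.
Set Implicit Arguments. Unset Strict Implicit. Unset Printing Implicit Defensive.
Import Order.TTheory GRing.Theory Num.Theory.
Import numFieldNormedType.Exports.
Local Open Scope classical_set_scope.
Local Open Scope ring_scope.

Section Defs.
Variable R : realType.

Definition cube (d : nat) : set 'rV[R]_d :=
  [set x | forall j : 'I_d, 0 <= x ord0 j <= 1].

Definition dquot d (j : 'I_d) (g : 'rV[R]_d -> R) (x : 'rV[R]_d) : R -> R :=
  fun h => h^-1 * (g (x + h *: delta_mx ord0 j) - g x).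

(* Filter h -> 0, h <> 0, with x + h e_j staying in the cube
   (one-sided derivatives at the boundary of X). *)
Definition dfilter d (j : 'I_d) (x : 'rV[R]_d) : set_system R :=
  within [set h : R | cube (x + h *: delta_mx ord0 j)] (0 : R)^'.

Definition pderiv d (j : 'I_d) (g : 'rV[R]_d -> R) (x : 'rV[R]_d) : R :=
  lim (dquot j g x @ dfilter j x).

Definition pderivable d (j : 'I_d) (g : 'rV[R]_d -> R) (x : 'rV[R]_d) : Prop :=
  cvg (dquot j g x @ dfilter j x).

(* Iterated partial derivative along a list of directions
   (a multi-index alpha with |alpha|_1 = size s, in some order). *)
Fixpoint pderivs d (s : seq 'I_d) (g : 'rV[R]_d -> R) : 'rV[R]_d -> R :=
  match s with
  | [::] => g
  | j :: s' => pderiv j (pderivs s' g)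
  end.

Definition Cm (d m : nat) (f : 'rV[R]_d -> R) : Prop :=
  (forall (s : seq 'I_d) (j : 'I_d) (x : 'rV[R]_d),
      (size s < m)%N -> cube x -> pderivable j (pderivs s f) x) /\
  (forall s : seq 'I_d, (size s <= m)%N ->
      {within @cube d, continuous (pderivs s f)}).

Definition Fclass (d m : nat) (B : R) : set ('rV[R]_d -> R) :=
  [set f | @Cm d m f /\
     forall (s : seq 'I_d) (x : 'rV[R]_d),
       (size s <= m)%N -> cube x -> `|pderivs s f x| <= B].

(* Integral over X = [0,1]^d with respect to Lebesgue measure, written as
   the iterated integral over the coordinates (Fubini).
   cube_int_aux k g x integrates coordinates 0..k-1 over [0,1], the
   remaining coordinates being taken from x. *)
Definition setcoord d (x : 'rV[R]_d) (k : nat) (t : R) : 'rV[R]_d :=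
  \row_(j < d) (if (j : nat) == k then t else x ord0 j).

Fixpoint cube_int_aux d (k : nat) (g : 'rV[R]_d -> R) (x : 'rV[R]_d) : R :=
  match k with
  | 0 => g x
  | k'.+1 => Rintegral lebesgue_measure `[0%R, 1%R]
               (fun t => cube_int_aux k' g (setcoord x k' t))
  end.

Definition cube_int d (g : 'rV[R]_d -> R) : R := cube_int_aux d g 0.

Definition logpart d (f : 'rV[R]_d -> R) : R := ln (cube_int (fun x => expR (f x))).

(* Deterministic adaptive algorithm with n function evaluations:
   the k-th node is [node (f(x_1),...,f(x_{k-1}))], and the output is
   [out (f(x_1),...,f(x_n))]. *)
Record adaptive_alg (d : nat) := AdaptiveAlg {
  node : seq R -> 'rV[R]_d;
  out : seq R -> R }.

Definition admissible d (A : adaptive_alg d) : Prop :=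
  forall v : seq R, cube (node A v).

Fixpoint info d (A : adaptive_alg d) (f : 'rV[R]_d -> R) (k : nat) : seq R :=
  match k with
  | 0 => [::]
  | k'.+1 => let v := info A f k' in rcons v (f (node A v))
  end.

Definition run d (n : nat) (A : adaptive_alg d) (f : 'rV[R]_d -> R) : R :=
  out A (info A f n).

Definition worst_err d (n : nat) (F : set ('rV[R]_d -> R))
    (dO : measure_display) (O : measurableType dO) (P : probability O R)
    (S : O -> adaptive_alg d) : \bar R :=
  ereal_sup [set (\int[P]_(w in [set: O]) (`|logpart f - run n (S w) f|)%:E)%E
            | f in F].

Definition sigma_ad d (n : nat) (F : set ('rV[R]_d -> R)) : \bar R :=
  ereal_inf [set e | exists (dO : measure_display) (O : measurableType dO)
                            (P : probability O R) (S : O -> adaptive_alg d),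
     (forall w, admissible (S w)) /\
     (forall f, F f -> measurable_fun [set: O] (fun w => run n (S w) f)) /\
     e = worst_err n F P S].

End Defs.

(* Main.v *)
Require Import Defs.
From HB Require Import structures.
From mathcomp Require Import all_boot all_order all_algebra.
From mathcomp Require Import all_classical all_reals all_analysis.
From mathcomp Require Import ring lra zify.
Set Implicit Arguments.
Unset Strict Implicit.
Unset Printing Implicit Defensive.
Import Order.TTheory GRing.Theory Num.Theory.
Import numFieldNormedType.Exports.
Local Open Scope classical_set_scope.
Local Open Scope ring_scope.

(** Half of the evaluations are spent on a uniform grid of [p ^ d <= n] points.
    Two functions of the class that agree on it differ by at most
    [delta = O(B n^(-m/d))] on the cube: Taylor expansion combined with Lagrange
    weights gives this along a line, and the estimate propagates from one
    coordinate to the next.  So any [f'] of the class that interpolates the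
    observed values of [f] satisfies [|L_f - L_f'| <= delta], which is the first
    bound.

    For the second bound, [L_f - L_f' = ln E[exp (f - f')]] where the expectation
    is over the density proportional to [exp f'].  The remaining evaluations
    estimate this expectation by Monte Carlo; as [exp (f - f')] lies in
    [[exp (-delta), exp delta]], the standard deviation is
    [O(delta exp delta n^(-1/2))] and [ln] is [exp delta]-Lipschitz there.

    Since only upper bounds are needed, the sampling density is discretised
    to [K] equiprobable atoms of a fine grid, with an error made as small as
    desired uniformly over the class.  The probability space is then the finite
    uniform space of maps ['I_N -> 'I_K]. *)

(** * Taylor expansion and interpolation on a line *)

Section OneDimensional.
Variable R : realType.
Implicit Types (m k : nat) (M s t x : R).

(** The bound on [dr] is asked only at points no farther from [t] than [x], so that a bound growing
    with the distance to [t] may be used for [M]. *)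
Lemma mvt_le (r dr : R -> R) M t x : 0 <= t <= 1 -> 0 <= x <= 1 ->
  (forall y : R, 0 < y < 1 -> is_derive y 1 r (dr y)) ->
  {within `[0, 1], continuous r} ->
  (forall y : R, 0 <= y <= 1 -> `|y - t| <= `|x - t| -> `|dr y| <= M) ->
  `|r x - r t| <= M * `|x - t|.
Proof.
move=> t01 x01 Hd Hc HM.
have main a b : 0 <= a -> b <= 1 -> a < b ->
    (forall y, a < y < b -> `|y - t| <= `|x - t|) ->
    `|r b - r a| <= M * `|b - a|.
  move=> a0 b1 ab Hy.
  have [||c cab ->] := @MVT R r dr a b ab.
  - by move=> y; rewrite in_itv /= => /andP[ay yb]; apply: Hd; lra.
  - apply: continuous_subspaceW Hc => y /=; rewrite !in_itv /= => /andP[ay yb].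
    by lra.
  - rewrite normrM ler_wpM2r //; move: cab; rewrite in_itv /= => cab.
    by apply: HM; [lra | apply: Hy].
have [xt|tx|->] := ltgtP x t; last by rewrite !subrr normr0 mulr0.
- rewrite distrC [`|x - t|]distrC; apply: main; [lra|lra|lra|].
  by move=> y /andP[xy yt]; rewrite !ltr0_norm; lra.
- apply: main; [lra|lra|lra|].
  by move=> y /andP[xy yt]; rewrite !gtr0_norm; lra.
Qed.

(** Induction on [m], with [h k] as the k-th derivative: the derivative of the remainder is the
    remainder of the shifted sequence, one order lower, and [mvt_le] supplies the missing factor.
    The factorial in the usual bound is given up. *)
Lemma taylor_le m (h : nat -> R -> R) M :
  (forall k, (k < m)%N -> forall t : R, 0 < t < 1 ->
     is_derive t 1 (h k) (h k.+1 t)) ->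
  (forall k, (k < m)%N -> {within `[0, 1], continuous (h k)}) ->
  (forall t, 0 <= t <= 1 -> `|h m t| <= M) ->
  forall t x, 0 <= t <= 1 -> 0 <= x <= 1 ->
  `|h 0 x - \sum_(k < m) h k t / k`!%:R * (x - t) ^+ k| <= M * `|x - t| ^+ m.
Proof.
elim: m h => [|m IH] h Hd Hc HM t x t01 x01.
  by rewrite big_ord0 subr0 expr0 mulr1 HM.
pose T y := \sum_(k < m.+1) h k t / k`!%:R * (y - t) ^+ k.
pose dT y := \sum_(k < m) h k.+1 t / k`!%:R * (y - t) ^+ k.
have dTE (y : R) : is_derive y 1 T (dT y).
  have -> : T = \sum_(k < m.+1) (fun z : R => h k t / k`!%:R * (z - t) ^+ k).
    by apply/funext => z; rewrite fct_sumE.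
  pose dh (k : 'I_m.+1) := h k t / k`!%:R * (k%:R * (y - t) ^+ k.-1).
  have -> : dT y = \sum_k dh k.
    rewrite big_ord_recl /dh /= mul0r mulr0 add0r; apply: eq_bigr => k _.
    rewrite /bump /= add1n factS natrM.
    have k1 : k.+1%:R != 0 :> R by rewrite pnatr_eq0.
    have kf : k`!%:R != 0 :> R by rewrite pnatr_eq0 -lt0n fact_gt0.
    by move: k1 kf; move: k.+1%:R k`!%:R => a b a0 b0; field; apply/andP.
  apply: is_derive_sum => k.
  have -> : (fun z : R => h k t / k`!%:R * (z - t) ^+ k) =
      (h k t / k`!%:R) *: ((@id R - cst t) ^+ k).
    by apply/funext => z; rewrite !fctE.
  rewrite /dh; apply: is_derive_eq.
  by rewrite /GRing.scale /= subr0 mulr1 !fctE.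
have TE : T t = h 0 t.
  rewrite /T big_ord_recl /= subrr expr0 mulr1 fact0 divr1 big1 ?addr0 // => k _.
  by rewrite expr0n /= mulr0.
pose r := h 0 - T.
have rE : h 0 x - T x = r x - r t.
  by rewrite /r !fctE TE subrr subr0.
rewrite -/(T x) rE exprSr mulrA.
apply: (@mvt_le r (fun y => h 1 y - dT y)) => //.
- by move=> y y01; have ? := Hd 0%N isT y y01; have ? := dTE y; exact: is_deriveB.
- apply: within_continuousB; first exact: Hc.
  by apply: continuous_subspaceT => y; apply: differentiable_continuous;
     apply/derivable1_diffP; have [] := dTE y.
- move=> y y01 yx.
  apply: (le_trans (IH (fun k => h k.+1) _ _ _ t y _ _)) => //.
  + by move=> k km u u01; apply: Hd.
  + by move=> k km; apply: Hc.
  + rewrite ler_wpM2l // ?lerXn2r ?nnegrE //.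
    by apply: le_trans (HM t t01).
Qed.

(** Interpolation at [m] distinct nodes reproduces polynomials of degree below [m]; this is applied
    to the powers of [X - t], evaluated at [t]. The product formula is kept to estimate the
    weights. *)
Lemma lagrange_weights m (u : nat -> R) t :
  (forall i j, (i < m)%N -> (j < m)%N -> u i = u j -> i = j) ->
  exists w : 'I_m -> R,
    (forall k, (k < m)%N -> \sum_(l < m) w l * (u l - t) ^+ k = (k == 0)%:R) /\
    (forall l, w l = \prod_(j < m | j != l) ((t - u j) / (u l - u j))).
Proof.
move=> uinj.
pose w (l : 'I_m) := \prod_(j < m | j != l) ((t - u j) / (u l - u j)).
exists w; split => // k km.
pose ell (l : 'I_m) : {poly R} :=
  \prod_(j < m | j != l) ((u l - u j)^-1 *: ('X - (u j)%:P)).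
pose q : {poly R} := ('X - t%:P) ^+ k.
pose p := (\sum_(l < m) q.[u l] *: ell l) - q.
have ell_t l : (ell l).[t] = w l.
  rewrite /ell horner_prod; apply: eq_bigr => j _.
  by rewrite hornerZ hornerXsubC mulrC.
have ell_u (l i : 'I_m) : (ell l).[u i] = (l == i)%:R.
  rewrite /ell horner_prod; case: eqVneq => [->|li].
    rewrite big1 // => j ji; rewrite hornerZ hornerXsubC mulVf // subr_eq0.
    by apply: contra ji => /eqP /uinj /val_inj ->.
  rewrite (bigD1 i) 1?eq_sym //= hornerZ hornerXsubC subrr mulr0 mul0r //.
have szell l : (size (ell l) <= m)%N.
  rewrite /ell; apply: leq_trans (size_poly_prod_leq _ _) _.
  apply: (@leq_trans ((\sum_(j < m | j != l) 2).+1 - #|[pred j | j != l]|)%N).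
    apply: leq_sub2r; rewrite ltnS; apply: leq_sum => j _.
    by apply: leq_trans (size_scale_leq _ _) _; rewrite size_XsubC.
  rewrite sum_nat_const; have -> : #|[pred j | j != l]| = m.-1.
    rewrite -[RHS]/(m.-1) -[in RHS](card_ord m) -(cardC (pred1 l)) card1 add1n.
    exact: eq_card.
  by have := ltn_ord l; lia.
(* [p] has degree below [m] and vanishes at [m] distinct nodes. *)
have p0 : p = 0.
  apply/eqP/negP => /negP pn0.
  have := @max_poly_roots _ p [seq u (val i) | i <- enum 'I_m] pn0.
  rewrite size_map size_enum_ord.
  have szp : (size p <= m)%N.
    apply: leq_trans (size_polyD _ _) _; rewrite geq_max; apply/andP; split.
      apply: leq_trans (size_sum _ _ _) _; apply/bigmax_leqP => l _.
      exact: leq_trans (size_scale_leq _ _) (szell l).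
    by rewrite size_polyN /q size_exp_XsubC.
  rewrite ltnNge szp => H; suff: false by []; apply: H.
  - apply/allP => _ /mapP[i _ ->]; apply/rootP.
    rewrite /p hornerD hornerN horner_sum (bigD1 i) //= hornerZ ell_u eqxx mulr1.
    rewrite big1 ?addr0 ?subrr // => l li.
    by rewrite hornerZ ell_u (negbTE li) mulr0.
  - rewrite map_inj_in_uniq ?enum_uniq // => i j _ _ /uinj.
    by move=> /(_ (ltn_ord i) (ltn_ord j)) /val_inj.
have := congr1 (fun P : {poly R} => P.[t]) p0; rewrite /p hornerD hornerN horner0.
move/eqP; rewrite subr_eq0 => /eqP.
rewrite horner_sum /q horner_exp hornerXsubC subrr expr0n => <-.
by apply: eq_bigr => l _; rewrite hornerZ ell_t horner_exp hornerXsubC mulrC.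
Qed.

(* Expanding the node values around [t] by Taylor, the Lagrange weights kill all
   terms but the value at [t]. *)
Lemma interpolation_le m (h : nat -> R -> R) M s eps t (u : nat -> R) :
  0 < s ->
  (forall k, (k < m)%N -> forall t : R, 0 < t < 1 ->
     is_derive t 1 (h k) (h k.+1 t)) ->
  (forall k, (k < m)%N -> {within `[0, 1], continuous (h k)}) ->
  (forall t, 0 <= t <= 1 -> `|h m t| <= M) ->
  0 <= t <= 1 ->
  (forall l, (l < m)%N -> [/\ 0 <= u l <= 1, `|t - u l| <= m%:R * s &
     `|h 0%N (u l)| <= eps]) ->
  (forall i j, (i < m)%N -> (j < m)%N -> i != j -> s <= `|u i - u j|) ->
  (0 < m)%N ->
  `|h 0%N t| <= m%:R ^+ m.+1 * (eps + M * (m%:R * s) ^+ m).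
Proof.
move=> s0 Hd Hc HM t01 Hu usep m0.
have uinj i j : (i < m)%N -> (j < m)%N -> u i = u j -> i = j.
  move=> im jm uij; apply/eqP/negP => /negP ij.
  by have := usep i j im jm ij; rewrite uij subrr normr0 leNgt s0.
have [w [wk wE]] := lagrange_weights t uinj.
have M0 : 0 <= M by apply: le_trans (HM t t01).
have m1 : 1 <= m%:R :> R by rewrite ler1n.
(* Each factor of a weight is at most [m * s / s], and there are at most [m] factors. *)
have wle l : `|w l| <= m%:R ^+ m.
  rewrite wE normr_prod.
  apply: (@le_trans _ _ (\prod_(j < m | j != l) m%:R)).
    apply: ler_prod => j jl; rewrite normr_ge0 /= normrM normfV.
    have sep : s <= `|u l - u j| by apply: usep; rewrite // eq_sym.
    rewrite ler_pdivrMr ?(lt_le_trans s0) //.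
    have [_ tu _] := Hu j (ltn_ord j); apply: le_trans tu _.
    by rewrite ler_wpM2l // ler0n.
  rewrite prodr_const ler_weXn2l //.
  by apply: leq_trans (max_card _) _; rewrite card_ord.
pose rem l := h 0%N (u l) - \sum_(k < m) h k t / k`!%:R * (u l - t) ^+ k.
have htE : h 0%N t = \sum_(l < m) w l * (h 0%N (u l) - rem l).
  transitivity (\sum_(l < m) w l * \sum_(k < m) h k t / k`!%:R * (u l - t) ^+ k).
    under eq_bigr do rewrite mulr_sumr.
    rewrite exchange_big /=.
    transitivity (\sum_(k < m) h k t / k`!%:R * (val k == 0%N)%:R).
      rewrite (bigD1 (Ordinal m0)) //= fact0 divr1 mulr1 big1 ?addr0 // => k.
      by rewrite -val_eqE /= => /negbTE ->; rewrite mulr0.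
    apply: eq_bigr => k _; rewrite -(wk k (ltn_ord k)) mulr_sumr.
    by apply: eq_bigr => l _; rewrite mulrCA.
  by apply: eq_bigr => l _; rewrite /rem; congr (_ * _); ring.
rewrite htE.
apply: le_trans (ler_norm_sum _ _ _) _.
apply: (@le_trans _ _ (\sum_(l < m) m%:R ^+ m * (eps + M * (m%:R * s) ^+ m))).
  apply: ler_sum => l _; rewrite normrM; apply: ler_pM => //.
  have [u01 tu hu] := Hu l (ltn_ord l).
  apply: le_trans (ler_normB _ _) _; apply: lerD => //.
  apply: le_trans (taylor_le Hd Hc HM t01 u01) _.
  by rewrite ler_wpM2l // lerXn2r ?nnegrE // 1?distrC // mulr_ge0 // ltW.
by rewrite sumr_const card_ord -[leLHS]mulr_natl exprS mulrA.
Qed.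

End OneDimensional.

(** * Interpolation on the cube *)

Section CoordinateSlices.
Variables (R : realType) (d : nat).
Implicit Types (x y : 'rV[R]_d) (t h : R) (f g : 'rV[R]_d -> R).

Lemma setcoordE x k t (j : 'I_d) :
  setcoord x k t ord0 j = if (j : nat) == k then t else x ord0 j.
Proof. by rewrite mxE. Qed.

Lemma setcoord_shift x (j : 'I_d) t h :
  setcoord x j t + h *: delta_mx ord0 j = setcoord x j (h + t).
Proof.
apply/rowP => i; rewrite !mxE eqxx /= val_eqE.
by case: eqVneq => _; rewrite ?mulr1 ?mulr0 ?addr0 // addrC.
Qed.

Lemma setcoord_id x (j : 'I_d) : setcoord x j (x ord0 j) = x.
Proof. by apply/rowP => i; rewrite mxE val_eqE; case: eqVneq => // ->. Qed.

Lemma setcoordC x k l t h : k != l ->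
  setcoord (setcoord x k t) l h = setcoord (setcoord x l h) k t.
Proof.
move=> kl; apply/rowP => i; rewrite !mxE.
by case: eqVneq => // ->; rewrite eq_sym (negbTE kl).
Qed.

Lemma setcoord_setcoord x k t h : setcoord (setcoord x k t) k h = setcoord x k h.
Proof. by apply/rowP => i; rewrite !mxE; case: eqVneq. Qed.

Lemma cube_setcoord x k t : cube x -> 0 <= t <= 1 -> cube (setcoord x k t).
Proof. by move=> cx t01 j; rewrite setcoordE; case: eqP. Qed.

Lemma cube0 : cube (0 : 'rV[R]_d).
Proof. by move=> j; rewrite mxE lexx ler01. Qed.

Lemma slice_continuous g x (j : 'I_d) : cube x ->
  {within @cube R d, continuous g} ->
  {within `[0, 1], continuous (fun t => g (setcoord x j t))}.
Proof.
move=> cx /subspace_continuousP gc; apply/subspace_continuousP => t t01.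
have ct : cube (setcoord x j t).
  by apply: cube_setcoord => //; move: t01; rewrite /= in_itv.
move=> P /= NP; have := gc _ ct P NP; rewrite /= /nbhs /= => HP.
have sc : (fun u => setcoord x j u) @ t --> setcoord x j t.
  have E u : setcoord x j u = setcoord x j 0 + u *: delta_mx ord0 j.
    by rewrite setcoord_shift addr0.
  rewrite E; under eq_fun do rewrite E.
  by apply: cvgD; [exact: cvg_cst|exact: scalel_continuous].
change (nbhs t (fun u => `[0, 1]%classic u -> P (g (setcoord x j u)))).
apply: (@filterS R (nbhs t) _ _ _ _ (sc _ HP)) => u /= Pu u01; apply: Pu.
by apply: cube_setcoord => //; move: u01; rewrite in_itv.
Qed.

(** At an interior [t] small steps stay in the cube, so [dfilter] is the ordinary punctured
    neighbourhood of 0 and the partial derivative is the usual derivative of the slice. *)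
Lemma slice_derive g x (j : 'I_d) t : cube x -> 0 < t < 1 ->
  pderivable j g (setcoord x j t) ->
  is_derive t 1 (fun u => g (setcoord x j u)) (pderiv j g (setcoord x j t)).
Proof.
move=> cx t01 Hd.
have FE : dquot j g (setcoord x j t) @ dfilter j (setcoord x j t) =
    (fun h => h^-1 *: (g (setcoord x j (h *: 1 + t)) - g (setcoord x j t)))
      @ (0 : R)^'.
  have -> : (fun h => h^-1 *: (g (setcoord x j (h *: 1 + t))
      - g (setcoord x j t))) = dquot j g (setcoord x j t).
    by apply/funext => h; rewrite /dquot setcoord_shift /GRing.scale /= mulr1.
  congr (_ @ _); rewrite /dfilter; apply/funext => P; apply/propext; split.
    have near_in : \forall h \near (0 : R)^',
        cube (setcoord x j t + h *: delta_mx ord0 j).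
      have : \forall h \near (0 : R), 0 < h + t < 1.
        have tc : (fun h => h + t) @ (0 : R) --> t.
          rewrite -[X in _ --> X](add0r t).
          by apply: cvgD; [exact: cvg_id|exact: cvg_cst].
        have : nbhs t [set u | 0 < u < 1].
          have := @near_in_itvoo R 0 1 t; rewrite in_itv /= => /(_ t01).
          by apply: filterS => u; rewrite in_itv.
        by move/tc.
      move=> H; apply: cvg_within; move: H; apply: filterS => h h01.
      rewrite setcoord_shift; apply: cube_setcoord => //; lra.
    move=> PA; near=> h.
    have : cube (setcoord x j t + h *: delta_mx ord0 j) by near: h.
    by near: h.
  by apply: filterS => h Ph _.
split; first by rewrite /derivable -FE.
by rewrite /derive -FE.
Unshelve. all: by end_near. Qed.

Lemma Fclass_slice_derive m B f x (j : 'I_d) k : Fclass m B f -> cube x ->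
  (k < m)%N -> forall t : R, 0 < t < 1 ->
  is_derive t 1 (fun u => pderivs (nseq k j) f (setcoord x j u))
    (pderivs (nseq k.+1 j) f (setcoord x j t)).
Proof.
move=> [[Hd _] _] cx km t t01; apply: slice_derive => //.
apply: Hd; first by rewrite size_nseq.
by apply: cube_setcoord => //; lra.
Qed.

Lemma Fclass_slice_continuous m B f x (j : 'I_d) k : Fclass m B f -> cube x ->
  (k <= m)%N ->
  {within `[0, 1], continuous (fun u => pderivs (nseq k j) f (setcoord x j u))}.
Proof.
move=> [[_ Hc] _] cx km; apply: slice_continuous => //.
by apply: Hc; rewrite size_nseq.
Qed.

Lemma Fclass_slice_bound m B f x (j : 'I_d) k t : Fclass m B f -> cube x ->
  (k <= m)%N -> 0 <= t <= 1 ->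
  `|pderivs (nseq k j) f (setcoord x j t)| <= B.
Proof.
move=> [_ HB] cx km t01; apply: HB; first by rewrite size_nseq.
exact: cube_setcoord.
Qed.

Lemma Fclass_lipschitz m B f x (j : 'I_d) t h : (0 < m)%N -> Fclass m B f ->
  cube x -> 0 <= t <= 1 -> 0 <= h <= 1 ->
  `|f (setcoord x j h) - f (setcoord x j t)| <= B * `|h - t|.
Proof.
move=> m0 Ff cx t01 h01.
apply: (mvt_le (r := fun u => f (setcoord x j u))
  (dr := fun u => pderivs (nseq 1 j) f (setcoord x j u))) => //.
- exact: (Fclass_slice_derive j Ff cx m0).
- by have := Fclass_slice_continuous (j := j) (k := 0) Ff cx (leq0n m).
- by move=> y y01 _; apply: Fclass_slice_bound Ff cx _ _.
Qed.

(** Coordinates are treated in the order in which [cube_int_aux] integrates them, so the same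
    construction yields interpolation nodes and nodes of Riemann sums. *)
Fixpoint grid (p k : nat) x : seq 'rV[R]_d :=
  if k is k'.+1 then
    [seq y | i <- iota 0 p, y <- grid p k' (setcoord x k' (i%:R / p%:R))]
  else [:: x].

Lemma size_grid p k x : size (grid p k x) = (p ^ k)%N.
Proof.
elim: k x => [|k IH] x //=.
rewrite size_allpairs_dep; under eq_map do rewrite IH.
by rewrite sumnE big_map big_const_seq count_predT size_iota iter_addn_0 expnSr.
Qed.

Lemma grid_cube p k x : cube x -> {in grid p k x, forall y, cube y}.
Proof.
elim: k x => [|k IH] x cx y /=; first by rewrite inE => /eqP ->.
case/allpairsPdep => i [z [ip zg ->]]; apply: IH zg => //.
apply: cube_setcoord => //; move: ip; rewrite mem_iota add0n => /andP[_ ip].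
have p0 : 0 < p%:R :> R by rewrite ltr0n; lia.
by rewrite divr_ge0 ?ler0n //= ler_pdivrMr // mul1r ler_nat ltnW.
Qed.

Lemma mem_grid p k x y :
  (forall j : 'I_d, (j < k)%N -> exists2 i, (i < p)%N & y ord0 j = i%:R / p%:R) ->
  (forall j : 'I_d, (k <= j)%N -> y ord0 j = x ord0 j) ->
  (k <= d)%N -> y \in grid p k x.
Proof.
elim: k x => [|k IH] x Hlt Hge kd /=.
  by rewrite inE; apply/eqP/rowP => j; exact: Hge.
have [i ip yi] := Hlt (Ordinal kd) (leqnn _).
apply/allpairsPdep; exists i, y; split; rewrite ?mem_iota //.
apply: IH => [j jk|j kj|]; [by apply: Hlt; lia| |lia].
rewrite setcoordE; case: eqP => [jk|/eqP jk].
  by rewrite -yi; congr (y _ _); apply: val_inj.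
by apply: Hge; lia.
Qed.

(** One application of [interpolation_le] per coordinate: [c] is the constant before a coordinate is
    freed, and the added 1 is the Taylor error. *)
Definition interp_const m k : R :=
  iter k (fun c => m%:R ^+ m.+1 * (c + 1)) 0.

Lemma interp_const_ge0 m k : 0 <= interp_const m k.
Proof.
by elim: k => //= k IH; rewrite mulr_ge0 ?exprn_ge0 ?addr_ge0.
Qed.

(** Induction on the number [k] of coordinates that may leave the grid. To free coordinate [k],
    interpolate [f - g] on the line in that direction, whose nodes [i / p] are covered by the
    previous case. *)
Lemma sup_le_of_eq_grid m p B f g : (0 < m)%N -> (m <= p)%N ->
  Fclass m B f -> Fclass m B g ->
  {in grid p d 0, f =1 g} ->
  forall x, cube x ->
  `|f x - g x| <= interp_const m d * (2 * B * (m%:R / p%:R) ^+ m).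
Proof.
move=> m0 mp Ff Fg fg.
have p0 : 0 < p%:R :> R by rewrite ltr0n; lia.
suff main k : (k <= d)%N -> forall x, cube x ->
    (forall j : 'I_d, (k <= j)%N ->
       exists2 i, (i < p)%N & x ord0 j = i%:R / p%:R) ->
    `|f x - g x| <= interp_const m k * (2 * B * (m%:R / p%:R) ^+ m).
  by move=> x cx; apply: main => // j; rewrite leqNgt ltn_ord.
elim: k => [|k IH] kd x cx Hx.
  rewrite fg ?subrr ?normr0 /= ?mul0r //.
  apply: mem_grid => // j; first by move=> _; exact: Hx.
  by rewrite leqNgt ltn_ord.
pose j := Ordinal kd.
pose H l u := pderivs (nseq l j) f (setcoord x j u)
              - pderivs (nseq l j) g (setcoord x j u).
pose t := x ord0 j.
have t01 : 0 <= t <= 1 by exact: cx.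
(* First index of a block of [m] consecutive nodes within [m / p] of [t]; the minimum with [p - m]
   keeps the block on the grid when [t] is close to 1. *)
pose k0 := minn (Num.truncn (p%:R * t)) (p - m).
pose u l : R := (k0 + l)%:R / p%:R.
have HtE : f x - g x = H 0%N t by rewrite /H /t setcoord_id.
have tr := truncn_itv (mulr_ge0 (ltW p0) (proj1 (andP t01))).
have k0t : k0%:R <= p%:R * t.
  by apply: le_trans (proj1 (andP tr)); rewrite ler_nat geq_minl.
have tk0 : p%:R * t <= k0%:R + m%:R.
  rewrite /k0 /minn; case: ifP => _.
    apply: le_trans (ltW (proj2 (andP tr))) _.
    by rewrite -natrD ler_nat -addn1 leq_add2l.
  rewrite -natrD subnK //; rewrite -[leRHS]mulr1 ler_wpM2l ?ler0n //.
  by case/andP: t01.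
have k0m : (k0 + m <= p)%N by rewrite /k0; lia.
rewrite HtE; apply: le_trans.
  apply: (@interpolation_le R m H (2 * B) p%:R^-1
    (interp_const m k * (2 * B * (m%:R / p%:R) ^+ m)) t u) => //.
  - by rewrite invr_gt0.
  - move=> l lm v v01.
    have ? := Fclass_slice_derive j Ff cx lm v01.
    have ? := Fclass_slice_derive j Fg cx lm v01.
    exact: is_deriveB.
  - by move=> l lm; apply: within_continuousB;
      [apply: Fclass_slice_continuous Ff cx _|
       apply: Fclass_slice_continuous Fg cx _]; exact: ltnW.
  - move=> v v01; apply: le_trans (ler_normB _ _) _.
    have ? := Fclass_slice_bound j Ff cx (leqnn m) v01.
    have ? := Fclass_slice_bound j Fg cx (leqnn m) v01.
    by lra.
  - move=> l lm.
    have u01 : 0 <= u l <= 1.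
      rewrite divr_ge0 ?ler0n //= ler_pdivrMr // mul1r ler_nat; lia.
    split => //.
    + have -> : t - u l = (p%:R * t - k0%:R - l%:R) / p%:R.
        by rewrite /u natrD; field; rewrite gt_eqF.
      rewrite normrM normfV (gtr0_norm p0) ler_wpM2r ?invr_ge0 ?ler0n //.
      have lm' : l%:R <= m%:R :> R by rewrite ler_nat ltnW.
      have l0 : 0 <= l%:R :> R by [].
      by rewrite ler_norml; apply/andP; split; lra.
    + rewrite /H /=; apply: IH; [exact: ltnW|exact: cube_setcoord|].
      move=> i ki; rewrite setcoordE; case: eqP => [_|/eqP ik].
        by exists (k0 + l)%N => //; lia.
      by apply: Hx; move: ik => /=; lia.
  - move=> a b am bm ab.
    have -> : u a - u b = (a%:R - b%:R) / p%:R.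
      by rewrite /u !natrD; field; rewrite gt_eqF.
    rewrite normrM normfV (gtr0_norm p0) -[leLHS]mul1r ler_wpM2r ?invr_ge0 //.
    wlog lab : a b am bm ab / (a < b)%N.
      move=> W; case: (ltngtP a b) ab => // lab _; first by apply: W; lia.
      by rewrite distrC; apply: W; lia.
    rewrite distrC -natrB ?(ltnW lab) // normr_nat ler1n; lia.
by rewrite /= -/(interp_const m k) -[leRHS]mulrA [(_ + 1) * _]mulrDl mul1r.
Qed.

End CoordinateSlices.

(** * Riemann sums for iterated integrals *)

Section RiemannSums.
Variable R : realType.
Implicit Types (L t h : R).

Section Line.
Variables (L : R) (F : R -> R).
Hypothesis L0 : 0 <= L.
Hypothesis Fgt0 : forall t, 0 <= t <= 1 -> 0 < F t.
Hypothesis Flip : forall t h, 0 <= t <= 1 -> 0 <= h <= 1 ->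
  F t <= expR (L * `|t - h|) * F h.

(** Near [t], [F] is squeezed between two exponential multiples of [F t] that tend to [F t]. *)
Lemma loglip_continuous : {within `[0, 1], continuous F}.
Proof.
apply/subspace_continuousP => t; rewrite /= in_itv /= => t01.
have cvgE (a : R) : expR (a * `|h - t|) * F t @[h --> t] --> F t.
  rewrite -[X in _ --> X]mul1r -expR0 -(mulr0 a) -[in X in a * X](normr0 R).
  rewrite -(subrr t).
  apply: cvgM; last exact: cvg_cst.
  apply: continuous_cvg; first exact: continuous_expR.
  apply: cvgM; first exact: cvg_cst.
  apply: cvg_norm; apply: cvgB; [exact: cvg_id|exact: cvg_cst].
apply: (@squeeze_cvgr _ _ _ _ (fun h => expR (- L * `|h - t|) * F t)
   (fun h => expR (L * `|h - t|) * F t)).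
- apply: (@nearW R (nbhs t)) => h; rewrite /= in_itv /= => h01.
  rewrite Flip // andbT mulNr expRN mulrC ler_pdivrMr ?expR_gt0 //.
  by rewrite mulrC distrC Flip.
- exact: cvg_within_filter (cvgE (- L)).
- exact: cvg_within_filter (cvgE L).
Qed.

Lemma loglip_integrable :
  lebesgue_measure.-integrable `[0, 1] (EFin \o F).
Proof.
apply: continuous_compact_integrable; first exact: segment_compact.
exact: loglip_continuous.
Qed.

(** On a cell of length [1 / p], [F] stays within a factor [expR (L / p)] of its value at the left
    end. The error is multiplicative, so it becomes additive under [ln]. *)
Lemma loglip_riemann (p : nat) : (0 < p)%N ->
  expR (- (L / p%:R)) * (p%:R^-1 * \sum_(i <- iota 0 p) F (i%:R / p%:R)) <=
    Rintegral lebesgue_measure `[0, 1] F <=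
  expR (L / p%:R) * (p%:R^-1 * \sum_(i <- iota 0 p) F (i%:R / p%:R)).
Proof.
move=> p0; have pR : 0 < p%:R :> R by rewrite ltr0n.
have pn0 : p%:R != 0 :> R by rewrite gt_eqF.
have frac01 (k : nat) : (k <= p)%N -> 0 <= (k%:R / p%:R : R) <= 1.
  by move=> kp; rewrite divr_ge0 ?ler0n //= ler_pdivrMr // mul1r ler_nat.
(* Induction on the number of cells; these are open on the left, so that each is disjoint from the
   interval already treated. *)
suff main k : (k <= p)%N ->
    expR (- (L / p%:R)) * (p%:R^-1 * \sum_(i <- iota 0 k) F (i%:R / p%:R)) <=
      Rintegral lebesgue_measure `[0, k%:R / p%:R] F <=
    expR (L / p%:R) * (p%:R^-1 * \sum_(i <- iota 0 k) F (i%:R / p%:R)).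
  by have := main p (leqnn p); rewrite divff.
elim: k => [|k IH] kp.
  by rewrite big_nil mul0r !mulr0 set_itv1 Rintegral_set1 lexx.
have k01 := frac01 k (ltnW kp); have k101 := frac01 k.+1 kp.
have kk1 : k%:R / p%:R < k.+1%:R / p%:R :> R.
  by rewrite ltr_pM2r ?invr_gt0 // ltr_nat.
have subc : lebesgue_measure.-integrable
    `]k%:R / p%:R, k.+1%:R / p%:R] (EFin \o F).
  apply: integrableS loglip_integrable => //.
  by move=> t /=; rewrite !in_itv /=; lra.
have sub0 : lebesgue_measure.-integrable `[0, k.+1%:R / p%:R] (EFin \o F).
  apply: integrableS loglip_integrable => //.
  by move=> t /=; rewrite !in_itv /=; lra.
have -> : Rintegral lebesgue_measure `[0, k.+1%:R / p%:R] F =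
    Rintegral lebesgue_measure `[0, k%:R / p%:R] F +
    Rintegral lebesgue_measure `]k%:R / p%:R, k.+1%:R / p%:R] F.
  rewrite -(@Rintegral_itvB _ F (BLeft 0) _ (k%:R / p%:R)) //.
  - by rewrite addrC subrK.
  - by rewrite bnd_simp; case/andP: k01.
  - by rewrite bnd_simp ltW.
have mes : fine (@lebesgue_measure R `]k%:R / p%:R, k.+1%:R / p%:R]%classic)
    = p%:R^-1.
  rewrite lebesgue_measure_itv /= lte_fin kk1 /= -natr1.
  by field.
have cint (c : R) : lebesgue_measure.-integrable
    `]k%:R / p%:R, k.+1%:R / p%:R] (EFin \o cst c).
  have c01 : lebesgue_measure.-integrable `[0, 1] (EFin \o cst c).
    apply: continuous_compact_integrable; first exact: segment_compact.
    exact/continuous_subspaceT/cst_continuous.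
  apply: integrableS c01 => //.
  by move=> t /=; rewrite !in_itv /=; lra.
have dist t : t \in `]k%:R / p%:R, k.+1%:R / p%:R] ->
    0 <= t <= 1 /\ L * `|t - k%:R / p%:R| <= L / p%:R.
  rewrite in_itv /= => /andP[kt tk1]; split; first by lra.
  rewrite ler_wpM2l // ger0_norm; last by lra.
  by rewrite -natr1 mulrDl mul1r in tk1; lra.
have -> : iota 0 k.+1 = rcons (iota 0 k) k by rewrite -cats1 -addn1 iotaD.
rewrite -cats1 big_cat big_seq1 /=.
move: (IH (ltnW kp)) => /andP[lo hi].
have lo1 : expR (- (L / p%:R)) * (p%:R^-1 * F (k%:R / p%:R)) <=
    Rintegral lebesgue_measure `]k%:R / p%:R, k.+1%:R / p%:R] F.
  have -> : expR (- (L / p%:R)) * (p%:R^-1 * F (k%:R / p%:R)) =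
    Rintegral lebesgue_measure `]k%:R / p%:R, k.+1%:R / p%:R]
      (cst (expR (- (L / p%:R)) * F (k%:R / p%:R))).
    by rewrite Rintegral_cst // mes; ring.
  apply: le_Rintegral => //; first exact: cint.
  move=> t tk /=.
  have [t01 tL] := dist t tk.
  rewrite expRN mulrC ler_pdivrMr ?expR_gt0 // [leRHS]mulrC.
  apply: le_trans (Flip k01 t01) _.
  by rewrite distrC ler_wpM2r ?(ltW (Fgt0 t01)) // ler_expR.
have hi1 : Rintegral lebesgue_measure `]k%:R / p%:R, k.+1%:R / p%:R] F <=
    expR (L / p%:R) * (p%:R^-1 * F (k%:R / p%:R)).
  have -> : expR (L / p%:R) * (p%:R^-1 * F (k%:R / p%:R)) =
    Rintegral lebesgue_measure `]k%:R / p%:R, k.+1%:R / p%:R]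
      (cst (expR (L / p%:R) * F (k%:R / p%:R))).
    by rewrite Rintegral_cst // mes; ring.
  apply: le_Rintegral => //; first exact: cint.
  move=> t tk /=.
  have [t01 tL] := dist t tk.
  apply: le_trans (Flip t01 k01) _.
  by rewrite ler_wpM2r ?(ltW (Fgt0 k01)) // ler_expR.
by rewrite !mulrDr; apply/andP; split; apply: lerD.
Qed.

End Line.

Section Cube.
Variable d : nat.
Implicit Types (x y : 'rV[R]_d) (f g : 'rV[R]_d -> R).

(* Stable under integrating out one coordinate, which makes it a convenient
   substitute for Lipschitz continuity of [ln g]. *)
Definition loglip L g :=
  (forall x, cube x -> 0 < g x) /\
  (forall x (j : 'I_d) t h, cube x -> 0 <= t <= 1 -> 0 <= h <= 1 ->
     g (setcoord x j t) <= expR (L * `|t - h|) * g (setcoord x j h)).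

Lemma loglip_cube_int_aux L g k : 0 <= L -> loglip L g -> (k <= d)%N ->
  loglip L (cube_int_aux k g).
Proof.
move=> L0 Hg; elim: k => [|k IH] kd //=.
have [Gpos Glip] := IH (ltnW kd).
set G := cube_int_aux k g in Gpos Glip *.
pose jk := Ordinal kd.
have G01 x : cube x -> forall t, 0 <= t <= 1 -> 0 < G (setcoord x k t).
  by move=> cx t t01; apply: Gpos; exact: cube_setcoord.
have GL x : cube x -> forall t h, 0 <= t <= 1 -> 0 <= h <= 1 ->
    G (setcoord x k t) <= expR (L * `|t - h|) * G (setcoord x k h).
  by move=> cx t h; exact: (Glip x jk).
have Gint x : cube x -> lebesgue_measure.-integrable `[0, 1]
    (EFin \o (fun t => G (setcoord x k t))).
  by move=> cx; apply: (loglip_integrable (GL x cx)).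
split=> [x cx|x j t h cx t01 h01].
  (* Positivity comes from the lower Riemann bound with a single cell. *)
  have /andP[lo _] := loglip_riemann L0 (G01 x cx) (GL x cx) (ltn0Sn 0).
  apply: lt_le_trans lo; rewrite mulr_gt0 ?expR_gt0 // invr1 mul1r /=.
  by rewrite big_seq1 mul0r G01 // lexx ler01.
(* If [j] is the coordinate being integrated out, both sides contain the same integral and the
   factor is at least 1; otherwise the pointwise inequality is integrated. *)
have [jE|jk'] := eqVneq (j : nat) k.
  have E v : (fun u => G (setcoord (setcoord x j v) k u)) =
      (fun u => G (setcoord x k u)).
    by apply/funext => u; rewrite jE setcoord_setcoord.
  rewrite !E.
  rewrite ler_peMl //; last first.
    by rewrite -expR0 ler_expR mulr_ge0.
  by apply: Rintegral_ge0 => u u01; rewrite ltW // G01.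
rewrite -RintegralZl //; last by apply: Gint; exact: cube_setcoord.
apply: le_Rintegral => //.
- by apply: Gint; exact: cube_setcoord.
- have Gh := Gint (setcoord x j h) (cube_setcoord j cx h01).
  have := fun mI => integrableZl mI (expR (L * `|t - h|)) Gh.
  move=> /(_ (measurable_itv _)).
  by apply: eq_integrable => // u _; rewrite /= EFinM.
- move=> u; rewrite /= in_itv /= => u01; rewrite !(setcoordC _ _ _ jk').
  by apply: Glip => //; exact: cube_setcoord.
Qed.

Definition grid_mean (p k : nat) g x : R :=
  (p ^ k)%:R^-1 * \sum_(y <- grid p k x) g y.

Lemma grid_meanS p k g x : grid_mean p k.+1 g x =
  p%:R^-1 * \sum_(i <- iota 0 p) grid_mean p k g (setcoord x k (i%:R / p%:R)).
Proof.
rewrite /grid_mean /= big_allpairs_dep /= -mulr_sumr mulrA; congr (_ * _).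
by rewrite expnS natrM invfM.
Qed.

(** After integrating [k] coordinates the function is still [loglip], so the estimate on a line
    applies again; each coordinate costs one exponential factor. *)
Lemma cube_int_aux_riemann L g p k x : 0 <= L -> loglip L g -> (0 < p)%N ->
  (k <= d)%N -> cube x ->
  expR (- (k%:R * (L / p%:R))) * grid_mean p k g x <= cube_int_aux k g x <=
  expR (k%:R * (L / p%:R)) * grid_mean p k g x.
Proof.
move=> L0 Hg p0; elim: k x => [|k IH] x kd cx.
  by rewrite /grid_mean /= big_seq1 expn0 invr1 mul1r mul0r oppr0 expR0 mul1r lexx.
have [Gpos Glip] := loglip_cube_int_aux L0 Hg (ltnW kd).
have /= /andP[lo hi] := @loglip_riemann L
  (fun t => cube_int_aux k g (setcoord x k t))
  L0 (fun t t01 => Gpos _ (cube_setcoord k cx t01))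
  (fun t h => Glip x (Ordinal kd) t h cx) p p0.
have i01 i : i \in iota 0 p -> cube (setcoord x k (i%:R / p%:R)).
  rewrite mem_iota add0n => /andP[_ ip]; apply: cube_setcoord => //.
  have pR : 0 < p%:R :> R by rewrite ltr0n.
  by rewrite divr_ge0 ?ler0n //= ler_pdivrMr // mul1r ler_nat ltnW.
rewrite grid_meanS -natr1 mulrDl mul1r opprD expRD expRD.
apply/andP; split.
- apply: le_trans lo; rewrite [expR _ * expR _]mulrC -mulrA ler_wpM2l ?expR_ge0 //.
  rewrite mulrCA ler_wpM2l ?invr_ge0 ?ler0n // mulr_sumr.
  rewrite big_seq [leRHS]big_seq; apply: ler_sum => i /i01 ci.
  by have /andP[] := IH _ (ltnW kd) ci.
- apply: le_trans hi _; rewrite [expR _ * expR _]mulrC -mulrA ler_wpM2l ?expR_ge0 //.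
  rewrite [leRHS]mulrCA ler_wpM2l ?invr_ge0 ?ler0n // mulr_sumr.
  rewrite big_seq [leRHS]big_seq; apply: ler_sum => i /i01 ci.
  by have /andP[] := IH _ (ltnW kd) ci.
Qed.

Lemma Fclass_loglip m B f : (0 < m)%N -> Fclass m B f ->
  loglip B (fun x => expR (f x)).
Proof.
move=> m0 Ff; split=> [x _|x j t h cx t01 h01]; first exact: expR_gt0.
rewrite -expRD ler_expR -lerBlDr; apply: le_trans (ler_norm _) _.
exact: Fclass_lipschitz Ff cx h01 t01.
Qed.

Lemma grid_mean_gt0 p f x : (0 < p)%N ->
  0 < grid_mean p d (fun y => expR (f y)) x.
Proof.
move=> p0; rewrite mulr_gt0 ?invr_gt0 ?ltr0n ?expn_gt0 ?p0 //.
have : (0 < size (grid p d x))%N by rewrite size_grid expn_gt0 p0.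
case: (grid p d x) => // y s _; rewrite big_cons.
by rewrite ltr_pwDl ?expR_gt0 // sumr_ge0 // => z _; exact: expR_ge0.
Qed.

(** The error depends on [f] only through [B], so one grid serves the whole class. *)
Lemma logpart_riemann m B f p : 0 <= B -> (0 < m)%N -> Fclass m B f ->
  (0 < p)%N ->
  `|logpart f - ln (grid_mean p d (fun y => expR (f y)) 0)| <=
    d%:R * (B / p%:R).
Proof.
move=> B0 m0 Ff p0.
have /andP[lo hi] := cube_int_aux_riemann B0 (Fclass_loglip m0 Ff) p0 (leqnn d)
  (@cube0 R d).
have Gp := grid_mean_gt0 f 0 p0.
have lop := lt_le_trans (mulr_gt0 (expR_gt0 _) Gp) lo.
have mp r := mulr_gt0 (expR_gt0 (r : R)) Gp.
move: lo hi; rewrite -ler_ln ?posrE // lnM ?posrE ?expR_gt0 // expRK => lo.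
rewrite -ler_ln ?posrE // lnM ?posrE ?expR_gt0 // expRK => hi.
rewrite /logpart /cube_int ler_norml; lra.
Qed.

End Cube.
End RiemannSums.

(** * Independent samples from a discretised density *)

Section FiniteSampling.
Variable R : realType.

(** Give [y] the integer part of [K * w y] as multiplicity and fill the remaining places with one
    fixed point. The rounding and the filling each cost at most [size s * C / K]. The atoms are
    chosen before [F]. *)
Lemma atoms_of_weights (T : eqType) (s : seq T) (w : T -> R) (K : nat) :
  (0 < K)%N -> (forall y, 0 <= w y) -> \sum_(y <- s) w y = 1 ->
  exists a : seq T, [/\ size a = K, {subset a <= s} &
    forall (F : T -> R) C, (forall y, y \in s -> `|F y| <= C) ->
    `|K%:R^-1 * \sum_(y <- a) F y - \sum_(y <- s) w y * F y| <=
      2 * (size s)%:R / K%:R * C].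
Proof.
move=> K0 w0 w1; have KR : 0 < K%:R :> R by rewrite ltr0n.
case: s w1 => [|y0 s'] w1.
  by move: w1; rewrite big_nil => /eqP; rewrite eq_sym oner_eq0.
set s := y0 :: s' in w1 *.
pose c y := Num.truncn (K%:R * w y).
have cle y : 0 <= K%:R * w y - (c y)%:R <= 1.
  have /andP[lo hi] := truncn_itv (mulr_ge0 (ltW KR) (w0 y)).
  by rewrite /c subr_ge0 lo /= lerBlDr -nat1r in hi *; rewrite addrC in hi; lra.
pose D : R := \sum_(y <- s) (K%:R * w y - (c y)%:R).
have DE : D = K%:R - (\sum_(y <- s) c y)%N%:R.
  by rewrite /D sumrB -mulr_sumr w1 mulr1 natr_sum.
have D0 : 0 <= D by apply: sumr_ge0 => y _; case/andP: (cle y).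
have Dle : D <= (size s)%:R.
  rewrite -[size s]count_predT -sum1_count natr_sum; apply: ler_sum => y _.
  by case/andP: (cle y).
have cK : (\sum_(y <- s) c y <= K)%N by rewrite -(ler_nat R) -subr_ge0 -DE.
exists (flatten [seq nseq (c y) y | y <- s] ++ nseq (K - \sum_(y <- s) c y) y0).
split.
- rewrite size_cat size_flatten size_nseq /shape -map_comp sumnE big_map.
  by under eq_bigr do rewrite /= size_nseq; rewrite subnKC.
- move=> y; rewrite mem_cat => /orP[/flatten_mapP[z zs]|].
    by rewrite mem_nseq => /andP[_ /eqP ->].
  by rewrite mem_nseq => /andP[_ /eqP ->]; rewrite mem_head.
- move=> F C HF.
  have C0 : 0 <= C by apply: le_trans (HF y0 (mem_head _ _)).
  have nseqE n y : \sum_(z <- nseq n y) F z = n%:R * F y.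
    by rewrite big_nseq iter_addr_0 mulr_natl.
  rewrite big_cat nseqE big_flatten big_map.
  under eq_bigr do rewrite nseqE.
  rewrite natrB // -DE.
  have -> : K%:R^-1 * (\sum_(y <- s) (c y)%:R * F y + D * F y0)
      - \sum_(y <- s) w y * F y =
      K%:R^-1 * (D * F y0 - \sum_(y <- s) (K%:R * w y - (c y)%:R) * F y).
    under [\sum_(y <- s) (K%:R * _ - _) * _]eq_bigr do rewrite mulrBl -mulrA.
    by rewrite sumrB -mulr_sumr; field; rewrite gt_eqF.
  rewrite normrM normfV (gtr0_norm KR) [leLHS]mulrC [leRHS]mulrAC.
  rewrite ler_wpM2r ?invr_ge0 ?ler0n //.
  apply: le_trans (ler_normB _ _) _.
  have H1 : `|D * F y0| <= (size s)%:R * C.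
    by rewrite normrM ger0_norm // ler_pM // HF // mem_head.
  suff H2 : `|\sum_(y <- s) (K%:R * w y - (c y)%:R) * F y| <= (size s)%:R * C.
    by apply: le_trans (lerD H1 H2) _; lra.
  apply: le_trans (ler_norm_sum _ _ _) _.
  apply: (@le_trans _ _ (D * C)); last by rewrite ler_wpM2r.
  rewrite mulr_suml big_seq [leRHS]big_seq; apply: ler_sum => y ys.
  have /andP[c0 _] := cle y.
  by rewrite normrM ger0_norm // ler_wpM2l // HF.
Qed.

Section IID.
Variables (N K : nat) (Y : 'I_K -> R) (sg : R).
Hypothesis Y_mean : \sum_k Y k = 0.
Hypothesis Y_le : forall k, `|Y k| <= sg.
Local Notation Omega := {ffun 'I_N -> 'I_K}.

(** Written as a product over all coordinates, the sum over [w] factorises, and the factor of [i] is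
    the sum of [Y]. *)
Lemma iid_uncorrelated (i j : 'I_N) : i != j ->
  \sum_(w : Omega) Y (w i) * Y (w j) = 0.
Proof.
move=> ij.
pose F (l : 'I_N) k := (if l == i then Y k else 1) * (if l == j then Y k else 1).
transitivity (\sum_(w : Omega) \prod_l F l (w l)).
  apply: eq_bigr => w _; rewrite /F big_split /=.
  by rewrite -!big_mkcond !big_pred1_eq.
rewrite -(bigA_distr_bigA F) (bigD1 i) //=.
under eq_bigr do rewrite /F eqxx (negbTE ij) mulr1.
by rewrite Y_mean mul0r.
Qed.

Lemma iid_second_moment :
  \sum_(w : Omega) (\sum_i Y (w i)) ^+ 2 <= #|{: Omega}|%:R * (N%:R * sg ^+ 2).
Proof.
under eq_bigr do rewrite expr2 mulr_suml.
rewrite exchange_big /=.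
have diag i : \sum_(w : Omega) Y (w i) * \sum_j Y (w j) <=
    #|{: Omega}|%:R * sg ^+ 2.
  under eq_bigr do rewrite mulr_sumr.
  rewrite exchange_big /= (bigD1 i) //= [X in _ + X]big1 ?addr0; last first.
    by move=> j ji; rewrite iid_uncorrelated // eq_sym.
  rewrite mulr_natl -sumr_const; apply: ler_sum => w _.
  rewrite -expr2 -real_normK ?num_real // lerXn2r ?nnegrE //.
  exact: le_trans (Y_le (w i)).
apply: le_trans (ler_sum _ (fun i _ => diag i)) _.
by rewrite sumr_const card_ord -[leLHS]mulr_natl mulrCA.
Qed.

(* Jensen's inequality in the form [2 |z| <= z ^+ 2 / c + c] with [c = sg * a]. *)
Lemma iid_mean_abs (a : R) : (0 < K)%N -> 0 < sg -> 0 < a -> N%:R * a ^+ 2 = 1 ->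
  #|{: Omega}|%:R^-1 * \sum_(w : Omega) `|N%:R^-1 * \sum_i Y (w i)| <= sg * a.
Proof.
move=> K0 sg0 a0 Na.
have c0 : 0 < sg * a by rewrite mulr_gt0.
have O0 : 0 < #|{: Omega}|%:R :> R.
  by rewrite ltr0n card_ffun !card_ord expn_gt0 K0.
have N0 : N%:R != 0 :> R.
  by apply: contraTneq (oner_neq0 R) => N0; rewrite -Na N0 mul0r eqxx.
rewrite mulrC ler_pdivrMr // mulrC.
apply: (@le_trans _ _ (\sum_(w : Omega)
  (2^-1 * ((sg * a)^-1 * (N%:R^-1) ^+ 2 * (\sum_i Y (w i)) ^+ 2 + sg * a)))).
  apply: ler_sum => w _; set z := \sum_i Y (w i).
  have -> : (sg * a)^-1 * N%:R^-1 ^+ 2 * z ^+ 2 =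
      `|N%:R^-1 * z| ^+ 2 / (sg * a).
    by rewrite real_normK ?num_real // exprMn; ring.
  set u := `|_|.
  have : 0 <= (u - sg * a) ^+ 2 / (sg * a).
    by rewrite mulr_ge0 ?sqr_ge0 // invr_ge0 ltW.
  have -> : (u - sg * a) ^+ 2 / (sg * a) = u ^+ 2 / (sg * a) - 2 * u + sg * a.
    by field; rewrite !gt_eqF.
  by lra.
rewrite -mulr_sumr big_split /= -mulr_sumr sumr_const -[X in _ + X]mulr_natl.
have := iid_second_moment.
set S := \sum_(w : Omega) _ => HS.
have : (sg * a)^-1 * N%:R^-1 ^+ 2 * S <= #|{: Omega}|%:R * (sg * a).
  apply: le_trans (ler_wpM2l _ HS) _.
    by rewrite mulr_ge0 ?invr_ge0 ?sqr_ge0 // ltW.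
  have -> : (sg * a)^-1 * N%:R^-1 ^+ 2 * (#|{: Omega}|%:R * (N%:R * sg ^+ 2)) =
      #|{: Omega}|%:R * (sg * (a^-1 * N%:R^-1)).
    by field; rewrite N0 !gt_eqF.
  have -> : a^-1 * N%:R^-1 = a.
    have : a^-1 * N%:R^-1 * (N%:R * a ^+ 2) = a by field; rewrite N0 gt_eqF.
    by rewrite Na mulr1.
  by [].
by lra.
Qed.

End IID.
End FiniteSampling.

(** * Two-stage algorithms on a finite probability space *)

Section TwoStage.
Variables (R : realType) (d : nat).
Variables (X : seq 'rV[R]_d) (Q : seq R -> seq 'rV[R]_d).
Variable (phi : seq R -> seq R -> R).
Implicit Types f : 'rV[R]_d -> R.

(** The number of values received tells the stage: the points of [X] are fixed, and those of [Q]
    depend on the first-stage values only. *)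
Definition two_stage : adaptive_alg R d :=
  {| node := fun v => if (size v < size X)%N then nth 0 X (size v)
                      else nth 0 (Q (take (size X) v)) (size v - size X);
     out := fun v => phi (take (size X) v) (drop (size X) v) |}.

(** Admissibility concerns value lists of any length; an index out of range gives the default point
    0, which lies in the cube. *)
Lemma nth_cube (s : seq 'rV[R]_d) i : {in s, forall x, cube x} ->
  cube (nth 0 s i).
Proof.
move=> Hs; case: (ltnP i (size s)) => is_.
  exact/Hs/mem_nth.
by rewrite nth_default //; exact: cube0.
Qed.

Lemma two_stage_admissible : {in X, forall x, cube x} ->
  (forall v, {in Q v, forall x, cube x}) -> admissible two_stage.
Proof. by move=> HX HQ v /=; case: ifP => _; apply: nth_cube. Qed.

Lemma info_first f k : (k <= size X)%N ->
  info two_stage f k = [seq f x | x <- take k X].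
Proof.
elim: k => [|k IH] kX /=; first by rewrite take0.
rewrite (IH (ltnW kX)) size_map size_takel ?kX ?(ltnW kX) //.
by rewrite (take_nth 0 kX) map_rcons.
Qed.

Lemma info_second f k : (k <= size (Q [seq f x | x <- X]))%N ->
  info two_stage f (size X + k) =
    [seq f x | x <- X] ++ [seq f x | x <- take k (Q [seq f x | x <- X])].
Proof.
elim: k => [|k IH] kQ.
  by rewrite addn0 info_first // take_size take0 cats0.
rewrite addnS /= (IH (ltnW kQ)) size_cat !size_map size_takel ?(ltnW kQ) //.
rewrite ltnNge leq_addr /= take_size_cat ?size_map // addKn.
by rewrite -cats1 -catA cats1 (take_nth 0 kQ) map_rcons.
Qed.

Lemma run_two_stage f N : size (Q [seq f x | x <- X]) = N ->
  run (size X + N) two_stage f =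
    phi [seq f x | x <- X] [seq f x | x <- Q [seq f x | x <- X]].
Proof.
move=> <-; rewrite /run info_second // take_size /=.
by rewrite take_size_cat ?drop_size_cat ?size_map.
Qed.

End TwoStage.

Section UniformProbability.
Variables (R : realType) (M : nat).

(** Uniform law on the integers up to [M], as a scaled sum of Dirac masses. Carried by [nat], where
    every set is measurable, it makes measurability of the algorithms automatic. *)
Definition uniform_nat : set nat -> \bar R :=
  mscale (M.+1%:R^-1)%:nng (msum (fun k => \d_k) M.+1).

HB.instance Definition _ := Measure.on uniform_nat.

Lemma uniform_nat_setT : uniform_nat setT = 1%E.
Proof.
transitivity ((M.+1%:R^-1)%:E * \sum_(k < M.+1) (\d_(k : nat) setT : \bar R))%E.
  by [].
under eq_bigr do rewrite diracT.
by rewrite sumEFin sumr_const card_ord -EFinM mulVf // pnatr_eq0.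
Qed.

HB.instance Definition _ :=
  Measure_isProbability.Build _ _ _ uniform_nat uniform_nat_setT.

Lemma integral_uniform_nat (g : nat -> R) : (forall k, 0 <= g k) ->
  (\int[uniform_nat]_(k in setT) (g k)%:E =
    (M.+1%:R^-1 * \sum_(k < M.+1) g k)%:E)%E.
Proof.
move=> g0; rewrite /uniform_nat ge0_integral_mscale //; last first.
  by move=> k _; rewrite lee_fin.
rewrite ge0_integral_measure_sum //; last by move=> k _; rewrite lee_fin.
rewrite EFinM; congr (_ * _)%E; rewrite -sumEFin; apply: eq_bigr => k _.
by rewrite integral_dirac // diracT mul1e.
Qed.

End UniformProbability.

(** Enumerating [Omega] carries its uniform law to [uniform_nat], so the expected error becomes a
    finite average. *)
Lemma sigma_ad_le_mean (R : realType) (d n : nat) (F : set ('rV[R]_d -> R))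
    (Omega : finType) (S : Omega -> adaptive_alg R d) (b : R) :
  (0 < #|Omega|)%N -> (forall w, admissible (S w)) ->
  (forall f, F f ->
     #|Omega|%:R^-1 * \sum_w `|logpart f - run n (S w) f| <= b) ->
  (sigma_ad n F <= b%:E)%E.
Proof.
move=> O0 HS Hb.
have /card_gt0P[w0 _] := O0.
pose S' k := S (nth w0 (enum Omega) k).
have ME : #|Omega|.-1.+1 = #|Omega| by rewrite prednK.
apply: (@le_trans _ _ (worst_err n F
    (@uniform_nat R #|Omega|.-1 : probability nat R) S')).
  apply: ereal_inf_lbound; exists _, nat, (@uniform_nat R #|Omega|.-1), S'.
  by split=> [k|]; [exact: HS|split].
apply: ge_ereal_sup => _ [f Ff <-].
rewrite (@integral_uniform_nat R #|Omega|.-1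
  (fun k => `|logpart f - run n (S' k) f|)) //.
rewrite lee_fin ME; apply: le_trans (Hb f Ff).
rewrite -(big_mkord predT (fun k => `|logpart f - run n (S' k) f|)).
by rewrite -[index_enum _]enumT (big_nth w0) -cardE.
Qed.

(** * Error of the importance sampling estimator *)

Section LogMean.
Variable R : realType.
Implicit Types (u v delta : R).

(** For [a <= b], [ln (b / a)] is at most [(b - a) / a], and [1 / a] is at most [expR delta]. *)
Lemma ln_lipschitz delta u v : expR (- delta) <= u -> expR (- delta) <= v ->
  `|ln u - ln v| <= expR delta * `|u - v|.
Proof.
have main a b : expR (- delta) <= a -> a <= b ->
    `|ln b - ln a| <= expR delta * `|b - a|.
  move=> da ab.
  have a0 : 0 < a := lt_le_trans (expR_gt0 _) da.
  have b0 : 0 < b := lt_le_trans a0 ab.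
  rewrite !ger0_norm ?subr_ge0 ?ler_ln ?posrE // -ln_div ?posrE //.
  have -> : b / a = 1 + (b - a) / a by field; rewrite gt_eqF.
  have ba0 : 0 <= (b - a) / a by rewrite divr_ge0 ?subr_ge0 // ltW.
  apply: le_trans (le_ln1Dx _) _; first by lra.
  rewrite mulrC ler_wpM2r ?subr_ge0 //.
  by rewrite -[leRHS]invrK -expRN lef_pV2 ?posrE ?expR_gt0.
move=> du dv; have [uv|/ltW vu] := leP u v; last exact: main.
by rewrite distrC [`|u - v|]distrC; exact: main.
Qed.

Lemma expR_gap delta : 0 <= delta ->
  expR delta - expR (- delta) <= 2 * delta * expR delta.
Proof.
move=> d0.
have -> : expR (- delta) = expR (- (2 * delta)) * expR delta.
  by rewrite -expRD; congr expR; ring.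
have := expR_ge1Dx (- (2 * delta)); have := expR_gt0 delta.
by move: (expR delta) (expR (- _)) => a b a0 ab; nra.
Qed.

Section Samples.
Variables (N K : nat) (X : 'I_K -> R) (E delta beta : R).
Hypothesis K0 : (0 < K)%N.
Hypothesis delta0 : 0 < delta.
Hypothesis X_itv : forall k, expR (- delta) <= X k <= expR delta.
Hypothesis E_itv : expR (- delta) <= E <= expR delta.
Hypothesis X_mean : `|K%:R^-1 * \sum_k X k - E| <= beta.
Local Notation Omega := {ffun 'I_N -> 'I_K}.
Local Notation Z w := (N%:R^-1 * \sum_i X (w i)).

Lemma mean_itv (I : finType) (x : I -> R) : (0 < #|I|)%N ->
  (forall i, expR (- delta) <= x i <= expR delta) ->
  expR (- delta) <= #|I|%:R^-1 * \sum_i x i <= expR delta.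
Proof.
move=> I0 Hx; have IR : 0 < #|I|%:R :> R by rewrite ltr0n.
rewrite mulrC ler_pdivlMr // ler_pdivrMr // !mulr_natr -!sumr_const.
by apply/andP; split; apply: ler_sum => i _; case/andP: (Hx i).
Qed.

(** Holds for every sample, since both logarithms are at most [delta] in absolute value. *)
Lemma ln_mean_error_le (w : Omega) : `|ln E - ln (Z w)| <= 2 * delta.
Proof.
have ln_itv u : expR (- delta) <= u <= expR delta -> `|ln u| <= delta.
  move=> /andP[lo hi]; have u0 := lt_le_trans (expR_gt0 _) lo.
  by rewrite ler_norml -{1}[- delta]expRK -[X in _ && (_ <= X)]expRK
    !ler_ln ?posrE ?expR_gt0 // lo.
apply: le_trans (ler_normB _ _) _; rewrite mulr2n mulrDl mul1r.
apply: lerD; first exact: ln_itv.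
have [N0|N0] := posnP N; last first.
  apply: ln_itv.
  by have := @mean_itv 'I_N (fun i => X (w i)); rewrite card_ord; apply.
(* Without samples the estimate is [ln 0], which is 0 by convention. *)
have -> : N%:R = 0 :> R by rewrite N0.
by rewrite invr0 mul0r ln0 // normr0 ltW.
Qed.

(** [E - Z w] splits into a bias of at most [beta] and a centred mean, whose terms are bounded by
    [expR delta - expR (- delta)]. The number [a] is the inverse square root of [N]. *)
Lemma ln_mean_error_mean (a : R) : 0 < a -> N%:R * a ^+ 2 = 1 ->
  #|{: Omega}|%:R^-1 * \sum_(w : Omega) `|ln E - ln (Z w)| <=
    expR delta * (2 * delta * expR delta * a + beta).
Proof.
move=> a0 Na.
have O0 : 0 < #|{: Omega}|%:R :> R.
  by rewrite ltr0n card_ffun !card_ord expn_gt0 K0.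
have N0 : (0 < N)%N.
  by rewrite lt0n; apply: contra_eq_neq Na => ->; rewrite mul0r eq_sym oner_neq0.
have NR : N%:R != 0 :> R by rewrite pnatr_eq0 -lt0n.
pose mu := K%:R^-1 * \sum_k X k.
have mu_itv : expR (- delta) <= mu <= expR delta.
  by have := @mean_itv 'I_K X; rewrite card_ord; apply.
pose Y k := X k - mu.
have Y0 : \sum_k Y k = 0.
  rewrite sumrB sumr_const card_ord -[mu *+ K]mulr_natl /mu mulrA divff.
    by rewrite mul1r subrr.
  by rewrite pnatr_eq0 -lt0n.
have sg0 : 0 < 2 * delta * expR delta by rewrite !mulr_gt0 ?expR_gt0.
have Yle k : `|Y k| <= 2 * delta * expR delta.
  apply: le_trans (expR_gap (ltW delta0)).
  by have := X_itv k; rewrite /Y ler_norml; lra.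
have ZE (w : Omega) : Z w - mu = N%:R^-1 * \sum_i Y (w i).
  by rewrite sumrB sumr_const card_ord -[mu *+ N]mulr_natl; field.
have step (w : Omega) : `|ln E - ln (Z w)| <=
    expR delta * (`|N%:R^-1 * \sum_i Y (w i)| + beta).
  have Zlo : expR (- delta) <= Z w.
    by have := @mean_itv 'I_N (fun i => X (w i)); rewrite card_ord => /(_ N0) H;
      have /andP[] := H (fun i => X_itv (w i)).
  have /andP[Elo _] := E_itv.
  apply: le_trans (ln_lipschitz Elo Zlo) _.
  rewrite ler_wpM2l ?expR_ge0 // -ZE.
  have -> : E - Z w = - (Z w - mu) + - (mu - E) by ring.
  by apply: le_trans (ler_normD _ _) _; rewrite !normrN lerD.
apply: (@le_trans _ _ (#|{: Omega}|%:R^-1 * \sum_(w : Omega)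
    expR delta * (`|N%:R^-1 * \sum_i Y (w i)| + beta))).
  by rewrite ler_wpM2l ?invr_ge0 ?ler0n //; apply: ler_sum => w _.
rewrite -mulr_sumr mulrCA ler_wpM2l ?expR_ge0 // big_split /= mulrDr.
apply: lerD; first exact: iid_mean_abs Y0 Yle _ K0 sg0 a0 Na.
by rewrite sumr_const -[beta *+ _]mulr_natl mulrA mulVf ?mul1r // gt_eqF.
Qed.

End Samples.
End LogMean.

(** * Assembly: the two-stage estimator, the interpolation rate and the final constants *)

Section Assembly.
Variable R : realType.

Lemma natural_above (x : R) : exists2 G : nat, (0 < G)%N & x <= G%:R.
Proof.
exists (Num.truncn `|x|).+1 => //.
have /andP[_ hi] := truncn_itv (normr_ge0 x).
by apply: le_trans (ler_norm x) (ltW hi).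
Qed.

(** The assumption on [X] is what the first stage provides; [eta] absorbs both the Riemann error and
    the rounding of the sampling density. One algorithm satisfies both bounds. *)
Lemma two_stage_error d m N (B delta eta : R) (X : seq 'rV[R]_d) :
  (0 < m)%N -> 0 < B -> 0 < delta -> 0 < eta ->
  {in X, forall x, cube x} ->
  (forall f g, Fclass m B f -> Fclass m B g ->
     [seq f x | x <- X] = [seq g x | x <- X] ->
     forall x, cube x -> `|f x - g x| <= delta) ->
  exists (Omega : finType) (S : Omega -> adaptive_alg R d),
    [/\ (0 < #|Omega|)%N, forall w, admissible (S w) &
    forall f, Fclass m B f ->
      let err := #|Omega|%:R^-1 *
        \sum_w `|logpart f - run (size X + N) (S w) f| in
      err <= eta + 2 * delta /\
      (forall a, 0 < a -> N%:R * a ^+ 2 = 1 ->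
         err <= eta + expR (2 * delta) * (2 * delta * a + eta))].
Proof.
move=> m0 B0 delta0 eta0 HX Hrec.
(* [G] is chosen so that the Riemann errors of [f] and of its interpolant add up to at most
   [eta]. *)
have [G G0 HG] := natural_above (2 * (d%:R * B) / eta).
have GR : 0 < G%:R :> R by rewrite ltr0n.
have Geta : 2 * (d%:R * (B / G%:R)) <= eta.
  by move: HG; rewrite ler_pdivrMr // => HG; rewrite !mulrA ler_pdivrMr //; lra.
pose s := grid G d (0 : 'rV[R]_d).
have s_cube : {in s, forall x, cube x} by apply: grid_cube; exact: cube0.
have [K K0 HK] := natural_above (2 * (size s)%:R / eta).
have KR : 0 < K%:R :> R by rewrite ltr0n.
have Keta : 2 * (size s)%:R / K%:R <= eta.
  by move: HK; rewrite !ler_pdivrMr // [eta * _]mulrC.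
pose Zs (g : 'rV[R]_d -> R) := \sum_(y <- s) expR (g y).
have Zs0 g : 0 < Zs g.
  have := grid_mean_gt0 g (0 : 'rV[R]_d) G0.
  by rewrite pmulr_rgt0 // invr_gt0 ltr0n expn_gt0 G0.
have /boolp.choice[atoms Hat] : forall g, exists a : seq 'rV[R]_d,
    [/\ size a = K, {subset a <= s} &
      forall (F : 'rV[R]_d -> R) C, (forall y, y \in s -> `|F y| <= C) ->
      `|K%:R^-1 * \sum_(y <- a) F y
        - \sum_(y <- s) expR (g y) / Zs g * F y| <=
        2 * (size s)%:R / K%:R * C].
  move=> g; apply: atoms_of_weights => //.
    by move=> y; rewrite divr_ge0 ?expR_ge0 // ltW.
  by rewrite -mulr_suml -/(Zs g) divff // gt_eqF ?Zs0.
(* [rec v] is a function of the class with values [v] on [X], chosen from [v] alone; for values that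
   no function of the class attains, it is arbitrary. *)
have /boolp.choice[rec Hrecon] : forall v, exists g : 'rV[R]_d -> R,
    (exists2 f, Fclass m B f & [seq f x | x <- X] = v) ->
    Fclass m B g /\ [seq g x | x <- X] = v.
  move=> v.
  by have [[f Ff fv]|H] := pselect (exists2 f, Fclass m B f &
    [seq f x | x <- X] = v); [exists f | exists (cst 0)].
pose Q (w : {ffun 'I_N -> 'I_K}) v :=
  [seq nth 0 (atoms (rec v)) (w i) | i <- enum 'I_N].
pose phi (w : {ffun 'I_N -> 'I_K}) v u := logpart (rec v) +
  ln (N%:R^-1 * \sum_(i < N)
    expR (nth 0 u i - rec v (nth 0 (atoms (rec v)) (w i)))).
pose S w := two_stage X (Q w) (phi w).
exists {ffun 'I_N -> 'I_K}, S.
have O0 : (0 < #|{: {ffun 'I_N -> 'I_K}}|)%N.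
  by rewrite card_ffun !card_ord expn_gt0 K0.
split=> //.
  move=> w; apply: two_stage_admissible => // v _ /mapP[i _ ->].
  by apply: nth_cube => x xa; apply: s_cube; have [_ + _] := Hat (rec v); apply.
move=> f Ff err.
have [Ff' f'X] := Hrecon _ (ex_intro2 _ _ f Ff erefl).
set f' := rec [seq f x | x <- X] in Ff' f'X.
have ff' x : cube x -> `|f x - f' x| <= delta by apply: Hrec.
have [sza suba Hatoms] := Hat f'.
pose x_ (k : 'I_K) := nth 0 (atoms f') k.
have x_s k : x_ k \in s by apply/suba/mem_nth; rewrite sza.
pose Xk k := expR (f (x_ k) - f' (x_ k)).
pose E := \sum_(y <- s) expR (f' y) / Zs f' * expR (f y - f' y).
(* [E] is the discrete analogue of [expR (logpart f - logpart f')]. *)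
have EE : E = Zs f / Zs f'.
  rewrite /E /Zs mulr_suml; apply: eq_bigr => y _.
  by rewrite mulrAC -expRD addrC subrK.
have exp_itv y : cube y -> expR (- delta) <= expR (f y - f' y) <= expR delta.
  by move=> /ff'; rewrite ler_norml !ler_expR.
have E_itv : expR (- delta) <= E <= expR delta.
  have sum1 : \sum_(y <- s) expR (f' y) / Zs f' = 1.
    by rewrite -mulr_suml -/(Zs f') divff // gt_eqF ?Zs0.
  rewrite -[X in X <= _]mul1r -[X in _ && (_ <= X)]mul1r -sum1 !mulr_suml /E.
  have w0 y : 0 <= expR (f' y) / Zs f' by rewrite divr_ge0 ?expR_ge0 // ltW.
  by apply/andP; split; rewrite big_seq [leRHS]big_seq; apply: ler_sum => y ys;
    rewrite ler_wpM2l //; have /andP[] := exp_itv y (s_cube y ys).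
have X_mean : `|K%:R^-1 * \sum_k Xk k - E| <= eta * expR delta.
  have -> : \sum_k Xk k = \sum_(y <- atoms f') expR (f y - f' y).
    by rewrite (big_nth 0) sza big_mkord.
  apply: le_trans (Hatoms _ (expR delta) _) _.
    move=> y ys; rewrite ger0_norm ?expR_ge0 //.
    by have /andP[] := exp_itv y (s_cube y ys).
  by rewrite ler_wpM2r ?expR_ge0.
have X_itv k : expR (- delta) <= Xk k <= expR delta by exact/exp_itv/s_cube.
have errw w : `|logpart f - run (size X + N) (S w) f| <=
    eta + `|ln E - ln (N%:R^-1 * \sum_i Xk (w i))|.
  rewrite run_two_stage; last by rewrite size_map size_enum_ord.
  rewrite /phi -/f'.
  have -> : \sum_(i < N) expR (nth 0 [seq f x | x <- Q w [seq f x | x <- X]] i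
      - f' (nth 0 (atoms f') (w i))) = \sum_i Xk (w i).
    apply: eq_bigr => i _; rewrite /Q -/f' -map_comp.
    by rewrite (nth_map i) ?size_enum_ord //= nth_ord_enum.
  have lnE : ln E = ln (grid_mean G d (fun y => expR (f y)) 0)
      - ln (grid_mean G d (fun y => expR (f' y)) 0).
    rewrite -ln_div ?posrE ?grid_mean_gt0 // EE; congr ln.
    rewrite /grid_mean -/s -/(Zs f) -/(Zs f') invfM mulrACA divff ?mul1r //.
    by rewrite invr_eq0 pnatr_eq0 -lt0n expn_gt0 G0.
  have rf := logpart_riemann (ltW B0) m0 Ff G0.
  have rf' := logpart_riemann (ltW B0) m0 Ff' G0.
  rewrite lnE; set l1 := ln (grid_mean _ _ _ _) in rf *.
  set l2 := ln (grid_mean _ _ _ _) in rf' *; set lZ := ln (_ * _).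
  (* The first two differences are Riemann errors; the last term compares [ln E] with its Monte
     Carlo estimate. *)
  have -> : logpart f - (logpart f' + lZ) =
      (logpart f - l1) - (logpart f' - l2) + (l1 - l2 - lZ) by ring.
  apply: le_trans (ler_normD _ _) _; rewrite lerD2r.
  by apply: le_trans (ler_normB _ _) _; lra.
have errE : err <= eta + #|{: {ffun 'I_N -> 'I_K}}|%:R^-1 *
    \sum_(w : {ffun 'I_N -> 'I_K}) `|ln E - ln (N%:R^-1 * \sum_i Xk (w i))|.
  rewrite /err; apply: le_trans (ler_wpM2l _ (ler_sum _ (fun w _ => errw w))) _.
    by rewrite invr_ge0.
  rewrite big_split /= mulrDr sumr_const -[eta *+ _]mulr_natl mulrA mulVf ?mul1r //.
  by rewrite pnatr_eq0 -lt0n.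
split=> [|a a0 Na]; apply: le_trans errE _; rewrite lerD2l.
  rewrite mulrC ler_pdivrMr ?ltr0n // mulr_natr -sumr_const.
  by apply: ler_sum => w _; exact: ln_mean_error_le.
apply: le_trans (ln_mean_error_mean K0 delta0 X_itv E_itv X_mean a0 Na) _.
(* One factor [expR delta] is the Lipschitz constant of [ln]; the other comes from the spread of the
   samples and from the rounding error. *)
have -> : 2 * delta = delta + delta by ring.
by rewrite expRD le_eqVlt; apply/orP; left; apply/eqP; ring.
Qed.

(** Raise [n <= q ^ d] to the power [m / d]. *)
Lemma natr_powR_le (d m q n : nat) : (0 < d)%N -> (0 < n)%N -> (n <= q ^ d)%N ->
  1 <= q%:R ^+ m * n%:R `^ (- (m%:R / d%:R)) :> R.
Proof.
move=> d0 n0 nq.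
have nR : 0 < n%:R :> R by rewrite ltr0n.
have dR : d%:R != 0 :> R by rewrite pnatr_eq0 -lt0n.
rewrite powRN -ler_pdivrMr ?invr_gt0 ?powR_gt0 // invrK mul1r.
apply: (@le_trans _ _ ((q%:R ^+ d) `^ (m%:R / d%:R))).
  rewrite ge0_ler_powR ?nnegrE ?divr_ge0 ?exprn_ge0 ?ler0n //.
  by rewrite -natrX ler_nat.
rewrite -[_ ^+ d]powR_mulrn ?ler0n // -powRrM mulrCA divff // mulr1.
by rewrite powR_mulrn ?ler0n.
Qed.

Lemma reconstruction d m : (0 < d)%N -> (0 < m)%N ->
  exists2 c : R, 0 < c & forall n, (0 < n)%N ->
  exists X : seq 'rV[R]_d, [/\ size X = n, {in X, forall x, cube x} &
    forall B f g, 0 < B -> Fclass m B f -> Fclass m B g ->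
    [seq f x | x <- X] = [seq g x | x <- X] ->
    forall x, cube x -> `|f x - g x| <= c * B * n%:R `^ (- (m%:R / d%:R))].
Proof.
move=> d0 m0.
have c0 := interp_const_ge0 R m d.
pose c1 : R := interp_const R m d * (2 * m%:R ^+ m * 2 ^+ m).
have c10 : 0 <= c1 by rewrite !mulr_ge0 ?exprn_ge0.
have mm : 0 < m%:R ^+ m :> R by rewrite exprn_gt0 // ltr0n.
(* [c1] serves the case [m <= p], the other summand the case [p < m]. *)
exists (c1 + 2 * m%:R ^+ m); first by lra.
move=> n n0.
(* The largest grid with at most [n] points; it is then padded with the origin to exactly [n]. *)
have [p pn pmax] : exists2 p, (p ^ d <= n)%N & (n < p.+1 ^ d)%N.
  have ex : exists p, (p ^ d <= n)%N by exists 0%N; rewrite exp0n.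
  have bd p : (p ^ d <= n)%N -> (p <= n)%N.
    apply: leq_trans; case: p => [|p] //.
    by rewrite -{1}(expn1 p.+1) leq_pexp2l.
  case: (ex_maxnP ex bd) => p pn pmax; exists p => //.
  by rewrite ltnNge; apply/negP => /pmax; rewrite ltnn.
pose r : R := n%:R `^ (- (m%:R / d%:R)).
have r0 : 0 <= r by exact: powR_ge0.
exists (grid p d 0 ++ nseq (n - p ^ d) 0); split.
- by rewrite size_cat size_grid size_nseq subnKC.
- move=> x; rewrite mem_cat => /orP[/grid_cube|]; first by apply; exact: cube0.
  by rewrite mem_nseq => /andP[_ /eqP ->]; exact: cube0.
move=> B f g B0 Ff Fg fg x cx; rewrite -/r.
(* If [p < m] then [n <= m ^ d], so the rate is bounded below and the trivial bound [2 * B]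
   suffices. *)
have [mp|pm] := leqP m p; last first.
  have : 1 <= m%:R ^+ m * r.
    apply: natr_powR_le => //; apply: leq_trans (ltnW pmax) _.
    by rewrite leq_exp2r.
  have fB := proj2 Ff [::] x (leq0n _) cx; have gB := proj2 Fg [::] x (leq0n _) cx.
  move=> mr; apply: le_trans (ler_normB _ _) _.
  apply: le_trans (lerD fB gB) _; have c1r := mulr_ge0 c10 r0.
  have -> : (c1 + 2 * m%:R ^+ m) * B * r = B * (c1 * r + 2 * (m%:R ^+ m * r)).
    by ring.
  have -> : B + B = B * 2 by ring.
  by rewrite ler_pM2l //; lra.
have fg' : {in grid p d 0, f =1 g}.
  move: fg; rewrite !map_cat => /eqP; rewrite eqseq_cat ?size_map //.
  move=> /andP[/eqP fg _].
  by move=> y yg; apply/eq_in_map: y yg.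
apply: le_trans (sup_le_of_eq_grid m0 mp Ff Fg fg' cx) _.
have p0 : 0 < p%:R :> R by rewrite ltr0n; exact: leq_trans mp.
(* Since [p + 1 <= 2 * p], maximality of [p] gives [n <= (2 * p) ^ d]; hence the factor [2 ^+ m] in
   [c1]. *)
have : 1 <= (2 * p)%:R ^+ m * r.
  apply: natr_powR_le => //; apply: leq_trans (ltnW pmax) _.
  by rewrite leq_exp2r //; have : (0 < p)%N := leq_trans m0 mp; lia.
rewrite natrM exprMn => pr.
have pm0 : 0 < p%:R ^+ m :> R by rewrite exprn_gt0.
have : (p%:R ^+ m)^-1 <= 2 ^+ m * r.
  by rewrite -[leLHS]mul1r ler_pdivrMr //; lra.
move=> pr'.
have -> : interp_const R m d * (2 * B * (m%:R / p%:R) ^+ m) =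
    interp_const R m d * (2 * m%:R ^+ m) * B * (p%:R ^+ m)^-1.
  by rewrite exprMn exprVn; ring.
apply: (@le_trans _ _ (interp_const R m d * (2 * m%:R ^+ m) * B * (2 ^+ m * r))).
  by rewrite ler_wpM2l // !mulr_ge0 // ltW.
have -> : interp_const R m d * (2 * m%:R ^+ m) * B * (2 ^+ m * r) = c1 * B * r.
  by rewrite /c1; ring.
by rewrite !ler_wpM2r ?(ltW B0) // lerDl mulr_ge0 // ltW.
Qed.

End Assembly.

Lemma halves (n : nat) : (0 < n)%N ->
  [/\ (n - n./2 + n./2 = n)%N, (0 < n - n./2)%N, (n <= 2 * (n - n./2))%N,
      n./2 = 0%N -> n = 1%N & (0 < n./2)%N -> (n <= 4 * n./2)%N].
Proof. by move=> n0; split; lia. Qed.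

Theorem theorem6 (R : realType) (d m : nat) :
  (1 <= d)%N -> (1 <= m)%N ->
  exists C C' : R, 0 < C /\ 0 < C' /\
    forall (B : R) (n : nat), 0 < B -> (1 <= n)%N ->
      let r := n%:R `^ (- (m%:R / d%:R)) in
      (sigma_ad n (@Fclass R d m B) <=
        (C' * Num.min (B * r)
                      (expR (C * B * r) * B * (n%:R `^ (- (2%:R)^-1)) * r))%:E)%E.
Proof.
move=> d0 m0.
have [c c0 Hc] := reconstruction R d0 m0.
(* The first stage has only about [n / 2] points, which costs [2] to the power [m / d]. *)
pose c2 : R := c * 2 `^ (m%:R / d%:R).
have c20 : 0 < c2 by rewrite mulr_gt0 // powR_gt0.
exists (2 * c2), (2 + 4 * c2); split; first by lra.
split; first by lra.
move=> B n B0 n0 /=; set r := n%:R `^ (- (m%:R / d%:R)).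
have nR : 0 < n%:R :> R by rewrite ltr0n.
have r0 : 0 < r by rewrite powR_gt0.
pose a : R := n%:R `^ (- 2^-1).
have a0 : 0 < a by rewrite powR_gt0.
have a1 : a <= 1.
  by rewrite -(powRr0 n%:R) ler_powR ?ler1n // oppr_le0 invr_ge0.
have [] := halves n0; set N := n./2; set N1 := (n - N)%N.
move=> nE N10 nN1 N0n1 nN.
have [X [sX cX HX]] := Hc N1 N10.
pose delta := c2 * B * r.
have delta0 : 0 < delta by rewrite !mulr_gt0.
have half_rate : N1%:R `^ (- (m%:R / d%:R)) <= 2 `^ (m%:R / d%:R) * r.
  have N1R : 0 < N1%:R :> R by rewrite ltr0n.
  rewrite /r !powRN -[leLHS]mul1r ler_pdivrMr ?powR_gt0 //.
  rewrite mulrAC ler_pdivlMr ?powR_gt0 // mul1r -powRM ?ler0n //.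
  rewrite ge0_ler_powR ?nnegrE ?divr_ge0 ?mulr_ge0 ?ler0n //.
  by rewrite -natrM ler_nat.
have Hrec f g : Fclass m B f -> Fclass m B g ->
    [seq f x | x <- X] = [seq g x | x <- X] ->
    forall x, cube x -> `|f x - g x| <= delta.
  move=> Ff Fg fg x cx; apply: le_trans (HX B f g B0 Ff Fg fg x cx) _.
  have -> : delta = c * B * (2 `^ (m%:R / d%:R) * r) by rewrite /delta /c2; ring.
  by rewrite ler_wpM2l // mulr_ge0 ?ltW.
(* The discretisation error is allowed to be as large as the target rate [B * r * a], which is at
   most [B * r]. *)
pose eta := B * r * a.
have eta0 : 0 < eta by rewrite !mulr_gt0.
have [W [S [W0 Sadm Serr]]] :=
  two_stage_error N m0 B0 delta0 eta0 cX Hrec.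
apply: (sigma_ad_le_mean W0 Sadm) => f Ff.
have [err1 err2] := Serr f Ff; rewrite sX nE in err1 err2.
have Br0 : 0 < B * r by rewrite mulr_gt0.
have bound1 : eta + 2 * delta <= (2 + 4 * c2) * (B * r).
  have : eta <= B * r by rewrite /eta ler_piMr // ltW.
  have -> : delta = c2 * (B * r) by rewrite /delta mulrA.
  by have := mulr_gt0 c20 Br0; lra.
have e1 : 1 <= expR (2 * delta) by have := expR_ge1Dx (2 * delta); lra.
rewrite -/a minEle; case: ifP => _; first exact: le_trans err1 bound1.
have -> : 2 * c2 * B * r = 2 * delta by rewrite /delta; ring.
have -> : (2 + 4 * c2) * (expR (2 * delta) * B * a * r) =
    expR (2 * delta) * ((2 + 4 * c2) * eta) by rewrite /eta; ring.
(* Without second-stage samples [n = 1], so [a = 1] and the first bound already implies the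
   second. *)
have [N0|Npos] := posnP N.
  have a1E : a = 1 by rewrite /a (N0n1 N0) powR1.
  apply: (le_trans err1); apply: (le_trans bound1).
  have -> : eta = B * r by rewrite /eta a1E mulr1.
  by rewrite ler_peMl // mulr_ge0 ?ltW //; lra.
have NR : 0 < N%:R :> R by rewrite ltr0n.
pose b : R := N%:R `^ (- 2^-1).
have b0 : 0 < b by rewrite powR_gt0.
have Nb : N%:R * b ^+ 2 = 1.
  rewrite /b powRN exprVn -powR_mulrn ?powR_ge0 // -powRrM mulVf //.
  by rewrite powRr1 ?ler0n // divff // gt_eqF.
(* From [n <= 4 * N], by taking square roots. *)
have ba : b <= 2 * a.
  have four : (2 : R) = 4 `^ 2^-1.
    have -> : (4 : R) = 2 `^ 2 by rewrite powR_mulrn //; ring.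
    by rewrite -powRrM divff // powRr1.
  rewrite /a /b !powRN -[leLHS]mul1r ler_pdivrMr ?powR_gt0 //.
  rewrite mulrAC ler_pdivlMr ?powR_gt0 // mul1r.
  have -> : 2 * N%:R `^ 2^-1 = (4 * N%:R) `^ 2^-1 :> R.
    by rewrite powRM // -four.
  rewrite ge0_ler_powR ?nnegrE ?mulr_ge0 ?ler0n //.
  by rewrite -natrM ler_nat nN.
apply: (le_trans (err2 b b0 Nb)).
have db : 2 * delta * b <= 4 * c2 * eta.
  have -> : 4 * c2 * eta = 2 * delta * (2 * a) by rewrite /eta /delta; ring.
  by rewrite ler_wpM2l // mulr_ge0 // ltW.
move: e1 db eta0; move: (expR _) => e e1 db eta0.
have : eta <= e * eta by rewrite ler_peMl // ltW.
have : e * (2 * delta * b + eta) <= e * (4 * c2 * eta + eta).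
  by rewrite ler_wpM2l ?lerD2r //; lra.
have -> : e * ((2 + 4 * c2) * eta) = e * (4 * c2 * eta + eta) + e * eta by ring.
by lra.
Qed.
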